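(* Let $\mathcal T$ be a subsequential, complete transducer whose underlying graph is weakly connected. Then the following two assertions are equivalent: (d) There exists a constant $k\in\mathbb R$ such that the random variable $\mathsf{Output}(X_n)$ is quasi-deterministic with value $kn+\mathcal O(1)$. (e) There exists a constant $k\in\mathbb R$ such that $\delta(C)=k\,\mathds 1(C)$ holds for every directed cycle $C$ of the transducer.
   Context: A transducer consists of a finite set of states $\{1,\dots,S\}$, a finite input alphabet $\mathcal A_I\subseteq\mathbb R$ (with at least two elements), an output alphabet $\mathcal A_O\subseteq\mathbb R$, a set of transitions $\mathcal E\subseteq\{1,\dots,S\}^2\times\mathcal A_I$, output labels $\delta\colon\mathcal E\to\mathcal A_O$, and the initial state $1$. A transition $e=(s,t,\varepsilon)$ goes from $s$ to $t$ and has input label $\varepsilon$ and output label $\delta(e)$. The underlying graph is the directed multigraph (loops and parallel edges allowed) whose vertices are the states and whose edges are the transitions. The transducer is deterministic if for every state $s$ and $\varepsilon\in\mathcal A_I$ there is at most one $t$ with $(s,t,\varepsilon)\in\mathcal E$; complete if for every $s$ and $\varepsilon$ there is some such $t$; subsequential if it is deterministic, every state is final, and it has a final output $a\colon\{1,\dots,S\}\to\mathcal A_O$. The output of the transducer on an input word is the sequence of output labels along the unique path starting at state $1$ whose input labels are the word (read in a fixed direction, from right to left), together with the final output label of the last state of this path. $X_n$ is a uniformly distributed random word in $\mathcal A_I^n$ and $\mathsf{Output}(X_n)$ is the sum of the output sequence of the transducer if the input is $X_n$. The output sum is called quasi-deterministic (with value $kn+\mathcal O(1)$) if there is a constant $k\in\mathbb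 R$ such that $\mathsf{Output}(X_n)=kn+\mathcal O(1)$ holds for all $n$ and all inputs, i.e. the difference between the output sum and $kn$ is bounded uniformly over all $n$ and all input words in $\mathcal A_I^n$. A cycle is a strongly connected digraph in which every vertex has out-degree $1$ (a loop is a cycle of length $1$); a directed cycle of the transducer is a cycle in its underlying graph. For a function $g$ on transitions and a cycle $C$, $g(C)=\sum_{e\in C}g(e)$; $\mathds 1$ is the constant function $1$, so $\mathds 1(C)$ is the length of $C$, and $\delta(C)$ is the sum of the output labels of the transitions of $C$.
   Formalization: It is additionally assumed that every state is reachable from the initial state 1; with weak connectedness alone, a cycle unreachable from state 1 can have a different average output without affecting Output(X_n), so (d) would not imply (e). *)

(* Defs.v *)
From HB Require Import structures.
From mathcomp Require Import classical_sets.
From mathcomp Require Import all_boot all_order all_algebra.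
From mathcomp Require Import finmap reals.

Set Implicit Arguments.
Unset Strict Implicit.
Unset Printing Implicit Defensive.

Import Order.TTheory GRing.Theory Num.Theory.

Local Open Scope ring_scope.

(* [edge S A] is the type of all triples (s, t, eps). The state set 'I_S.+1 is
   nonempty and has S + 1 elements; the initial state, which is the first one,
   is [ord0]. *)
Definition edge (S : nat) (A : finType) : finType :=
  ('I_S.+1 * 'I_S.+1 * A)%type.

Definition src S A (e : edge S A) : 'I_S.+1 := e.1.1.
Definition tgt S A (e : edge S A) : 'I_S.+1 := e.1.2.
Definition inp S A (e : edge S A) : A := e.2.

Definition adj S A (C : {set edge S A}) : rel 'I_S.+1 :=
  fun s t => [exists e in C, (src e == s) && (tgt e == t)].

(* The values of [delta] outside [trans] are irrelevant. *)
Record transducer (R : realType) (S : nat) := Transducer {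
  in_alph : {fset R};
  in_alph_gt1 : (1 < #|` in_alph|)%N;
  out_alph : set R;
  trans : {set edge S in_alph};
  delta : edge S in_alph -> R;
  delta_out : forall e, e \in trans -> out_alph (delta e);
  final : {set 'I_S.+1}
}.

Section TransducerDefs.
Variables (R : realType) (S : nat) (T : transducer R S).

Definition deterministic : Prop :=
  forall (s : 'I_S.+1) (eps : in_alph T) (t1 t2 : 'I_S.+1),
    (s, t1, eps) \in trans T -> (s, t2, eps) \in trans T -> t1 = t2.

Definition complete : Prop :=
  forall (s : 'I_S.+1) (eps : in_alph T),
    exists t : 'I_S.+1, (s, t, eps) \in trans T.

Definition subsequential (a : 'I_S.+1 -> R) : Prop :=
  [/\ deterministic, final T = [set: 'I_S.+1]
    & forall s, out_alph T (a s)].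

Definition weakly_connected : Prop :=
  forall s t : 'I_S.+1,
    connect (fun x y => adj (trans T) x y || adj (trans T) y x) s t.

(* Every state is reachable from the initial state. This does not follow from
   weak connectedness, and without it a cycle that no run from the initial
   state can enter would have no influence on the outputs. *)
Definition accessible : Prop :=
  forall s : 'I_S.+1, connect (adj (trans T)) ord0 s.

Fixpoint walk (s : 'I_S.+1) (p : seq (edge S (in_alph T))) : bool :=
  if p is e :: p' then [&& e \in trans T, src e == s & walk (tgt e) p']
  else true.

(* [p] is a path from the initial state reading [w] from right to left. *)
Definition run n (w : n.-tuple (in_alph T))
    (p : n.-tuple (edge S (in_alph T))) : bool :=
  walk ord0 p && ([seq inp e | e <- p] == rev w).

Definition output_seq (a : 'I_S.+1 -> R) (p : seq (edge S (in_alph T))) :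
    seq R :=
  rcons [seq delta e | e <- p] (a (last ord0 [seq tgt e | e <- p])).

(* If the transducer is deterministic and complete, there is exactly one [p]
   with [run w p], so that the default value 0 is not used. *)
Definition Output (a : 'I_S.+1 -> R) n (w : n.-tuple (in_alph T)) : R :=
  if [pick p : n.-tuple (edge S (in_alph T)) | run w p] is Some p
  then \sum_(x <- output_seq a p) x else 0.

Definition quasi_deterministic (a : 'I_S.+1 -> R) (k : R) : Prop :=
  exists M : R, forall n (w : n.-tuple (in_alph T)),
    `|Output a w - k * n%:R| <= M.

(* The digraph with vertex set [V] and edge set [C] is a subgraph of the
   underlying graph. *)
Definition subgraph (V : {set 'I_S.+1}) (C : {set edge S (in_alph T)}) : Prop :=
  C \subset trans T /\ forall e, e \in C -> src e \in V /\ tgt e \in V.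

Definition directed_cycle (V : {set 'I_S.+1}) (C : {set edge S (in_alph T)}) :
    Prop :=
  [/\ subgraph V C,
      V != set0,
      forall s t, s \in V -> t \in V -> connect (adj C) s t
    & forall s, s \in V -> #|[set e in C | src e == s]| = 1%N].

Definition cycle_sum (g : edge S (in_alph T) -> R)
    (C : {set edge S (in_alph T)}) : R :=
  \sum_(e in C) g e.

End TransducerDefs.

Arguments Output {R S} T a {n} w.
Arguments quasi_deterministic {R S} T a k.
Arguments directed_cycle {R S} T V C.
Arguments cycle_sum {R S} T g C.
Arguments delta {R S} t e.

(* Main.v *)
(** The output of a run is the sum of the weights [delta] along a walk, up to a
    bounded final term.  Running around a cycle [m] times makes the deviation
    from [k n] grow like [m * (delta C - k * #|C|)], so boundedness forces every
    cycle to have mean [k].  Conversely, if [delta - k] sums to zero along every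
    cycle, cutting the simple cycles out of a walk does not change its sum, and
    what is left is a walk without repeated edges, whose sum is at most the
    total weight of all edges in absolute value. *)
Require Import Defs.
From mathcomp Require Import all_boot all_order all_algebra.
From mathcomp Require Import finmap reals.

Import Order.TTheory GRing.Theory Num.Theory.

Local Open Scope ring_scope.

Section Walks.

Context {R : realType} {S : nat} {T : transducer R S}.

Implicit Types (s t : 'I_S.+1) (e : edge S (in_alph T)).
Implicit Types (p q c : seq (edge S (in_alph T))).

Definition dest s p := last s [seq tgt e | e <- p].

Lemma dest_cat s p q : dest s (p ++ q) = dest (dest s p) q.
Proof. by rewrite /dest map_cat last_cat. Qed.

Lemma walk_cat s p q : walk s (p ++ q) = walk s p && walk (dest s p) q.
Proof. by elim: p s => //= e p IHp s; rewrite IHp !andbA. Qed.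

Lemma walk_sub_trans s p : walk s p -> {subset p <= trans T}.
Proof.
elim: p s => //= e p IHp s /and3P[eT _ /IHp pT] e'.
by rewrite inE => /predU1P[-> // | /pT].
Qed.

Lemma walk_connect (C : {set edge S (in_alph T)}) s p :
  walk s p -> {subset p <= C} -> connect (adj C) s (dest s p).
Proof.
elim: p s => [|e p IHp] s /=; first by rewrite connect0.
move=> /and3P[_ /eqP <- w_p] sub; apply: (@connect_trans _ _ (tgt e)); last first.
  by apply: IHp => // x xp; apply: sub; rewrite inE xp orbT.
by apply/connect1/exists_inP; exists e; rewrite ?eqxx //; apply: sub; rewrite mem_head.
Qed.

Lemma connect_walk s t :
  connect (adj (trans T)) s t -> exists2 p, walk s p & dest s p = t.
Proof.
case/connectP=> r; elim: r s => [|u r IHr] s /=.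
  by move=> _ ->; exists [::].
case/andP=> /exists_inP[e eT /andP[/eqP se /eqP te]] r_path t_last.
have [p w_p d_p] := IHr u r_path t_last.
by exists (e :: p); rewrite /= ?eT ?se ?te ?eqxx // /dest /= te.
Qed.

(** Each edge of [c] cuts the walk into a piece starting at [s] and a piece returning to [s], so all
    sources are mutually reachable through [s]. Distinctness of the sources gives out-degree one. *)
Lemma simple_closed_walk_cycle s c :
    c != [::] -> walk s c -> dest s c = s -> uniq [seq src e | e <- c] ->
  directed_cycle T [set x in [seq src e | e <- c]] [set e in c].
Proof.
move=> c_neq0 w_c d_c uniq_c.
have s_src : s \in [seq src e | e <- c].
  by case: c c_neq0 w_c {d_c uniq_c} => //= e c _ /and3P[_ /eqP ->]; rewrite mem_head.
have loop e : e \in c -> [/\ connect (adj [set x in c]) s (src e),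
    connect (adj [set x in c]) (src e) s & tgt e \in [seq src x | x <- c]].
  move=> ec; case/splitPr: ec w_c d_c s_src => c1 c2 w_c d_c s_src.
  move: w_c; rewrite walk_cat /= => /and4P[w_c1 eT /eqP d_c1 w_c2].
  rewrite d_c1; split.
  - by apply: walk_connect => // x xc1; rewrite inE mem_cat xc1.
  - rewrite -[X in connect _ _ X]d_c dest_cat -d_c1.
    apply: walk_connect; first by rewrite /= eT d_c1 eqxx.
    by move=> x xc; rewrite inE mem_cat xc orbT.
  (* The target of [e] is the source of the next edge, or [s] itself when [e] is the last edge. *)
  - case: c2 w_c2 d_c s_src => [|e2 c2] /=.
      by rewrite dest_cat /dest /= => _ ->.
    case/and3P=> _ /eqP <- _ _ _.
    by rewrite map_f // mem_cat !inE eqxx !orbT.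
split.
- split; first by apply/subsetP => e; rewrite inE => /(walk_sub_trans _ _ w_c).
  by move=> e; rewrite !inE => ec; have [_ _ ->] := loop e ec; rewrite map_f.
- by apply/set0Pn; exists s; rewrite inE.
- move=> x y; rewrite !inE => /mapP[e /loop[_ es _] ->] /mapP[e' /loop[se' _ _] ->].
  exact: connect_trans se'.
- move=> x; rewrite inE => /mapP[e ec ->].
  apply/eqP/cards1P; exists e; apply/setP => e'; rewrite !inE.
  apply/andP/eqP => [[e'c /eqP src_e']|-> //].
  have inj i : (i < size c)%N ->
      nth (src e) [seq src e | e <- c] i = src (nth e c i) by exact: nth_map.
  (* As the sources along [c] are distinct, the source of an edge determines its position in [c]. *)
  rewrite -(nth_index e e'c) -[RHS](nth_index e ec); congr nth.
  apply/eqP; rewrite -(nth_uniq (src e) _ _ uniq_c) ?size_map ?index_mem //.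
  by rewrite !inj ?index_mem // !nth_index // src_e'.
Qed.

(* With exactly one outgoing edge at each vertex, the cycle is the functional
   graph of its successor map; strong connectivity makes it a single orbit. *)
Lemma cycle_closed_walk (V : {set 'I_S.+1}) (C : {set edge S (in_alph T)}) :
    directed_cycle T V C ->
  exists s c, [/\ walk s c, dest s c = s, uniq c & C =i c].
Proof.
case=> [[C_sub C_V] /set0Pn[s sV] conn deg1].
have [e0 _] : exists e, e \in C.
  have /eqP/cards1P[e Ce] := deg1 s sV.
  by exists e; have := set11 e; rewrite -Ce inE => /andP[].
(* The edge of [C] leaving [x]; the default [e0] is taken only for [x] outside [V]. *)
pose out x := odflt e0 [pick e in C | src e == x].
have outP x : x \in V -> out x \in C /\ src (out x) = x.
  move=> xV; rewrite /out; case: pickP => [e /andP[eC /eqP] //|none].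
  have /eqP/cards1P[e Ce] := deg1 x xV.
  by have := set11 e; rewrite -Ce inE none.
have outK e : e \in C -> out (src e) = e.
  move=> eC; have [srcV _] := C_V e eC.
  have [outC src_out] := outP _ srcV.
  have /eqP/cards1P[e1 Ce] := deg1 _ srcV.
  have /set1P e_e1 : e \in [set e1] by rewrite -Ce inE eC eqxx.
  have /set1P out_e1 : out (src e) \in [set e1] by rewrite -Ce inE outC src_out eqxx.
  by rewrite out_e1.
pose f x := tgt (out x).
have fV x : x \in V -> f x \in V by case/outP=> /C_V[].
have adj_f x y : adj C x y -> f x = y.
  by case/exists_inP=> e eC /andP[/eqP <- /eqP <-]; rewrite /f outK.
have conn_f x y : connect (adj C) x y -> fconnect f x y.
  by apply: connect_sub => {}x {}y /adj_f <-; exact: fconnect1.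
have orbV x : x \in orbit f s -> x \in V.
  rewrite -fconnect_orbit => /iter_findex <-.
  by elim: (findex f s x) => //= n; exact: fV.
(* By strong connectivity [s] is reachable from [f s], so the orbit of [s] closes up at [s]. *)
have f_cyc : iter (order f s) f s = s.
  apply/(@orbitPcycle _ f s 2 4)/conn_f; apply: conn => //; exact: fV.
have dest_out n x : dest x [seq out y | y <- traject f x n] = iter n f x.
  elim: n x => //= n IHn x.
  by rewrite /dest /= -/(dest _ _) -/(f x) IHn -iterSr.
have walk_out n x : x \in V -> walk x [seq out y | y <- traject f x n].
  elim: n x => //= n IHn x xV; have [outC src_out] := outP x xV.
  by rewrite (subsetP C_sub) // src_out eqxx IHn //; exact: fV.
exists s, [seq out y | y <- orbit f s]; split.
- exact: walk_out.
- by rewrite dest_out.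
- rewrite map_inj_in_uniq ?orbit_uniq // => x y /orbV/outP[_ sx] /orbV/outP[_ sy].
  by move=> xy; rewrite -sx xy.
(* The orbit reaches every vertex of [V], and every edge of [C] is [out] of its source, so no edge
   is missed. *)
- move=> e; apply/idP/mapP => [eC|[x /orbV/outP[outC _] -> //]].
  exists (src e); last by rewrite outK.
  by rewrite -fconnect_orbit; apply/conn_f/conn => //; case: (C_V e eC).
Qed.

Lemma cycle_sum_seq (g : edge S (in_alph T) -> R) (C : {set edge S (in_alph T)}) c :
  uniq c -> C =i c -> cycle_sum T g C = \sum_(e <- c) g e.
Proof. by move=> uniq_c Cc; rewrite big_uniq //; apply: eq_bigl => e; rewrite Cc. Qed.

(** Build the reduced walk from the back. If the start [s] of the new edge [e] is already the source
    of some [e2] in the reduced walk, then [e] and the edges before [e2] form a closed walk with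
    distinct sources, that is, a cycle of weight zero; dropping it leaves a walk that starts with
    [e2]. *)
Lemma walk_sum_simple (g : edge S (in_alph T) -> R) :
    (forall V C, directed_cycle T V C -> cycle_sum T g C = 0) ->
  forall s p, walk s p -> exists q, [/\ walk s q, dest s q = dest s p,
    uniq [seq src e | e <- q] & \sum_(e <- q) g e = \sum_(e <- p) g e].
Proof.
move=> g0 s p; elim: p s => [|e p IHp] s /=; first by exists [::].
case/and3P=> eT /eqP src_e /IHp[q [w_q d_q uniq_q sum_q]].
have [s_q|s_q] := boolP (s \in [seq src x | x <- q]); last first.
  exists (e :: q); rewrite /= eT src_e eqxx w_q s_q uniq_q !big_cons sum_q.
  by rewrite /dest /= -!/(dest _ _) d_q.
case/mapP: s_q => e2 e2q s_e2.
case/splitPr: e2q w_q d_q uniq_q sum_q => c q2.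
rewrite walk_cat dest_cat map_cat cat_uniq big_cat /=.
move=> /and4P[w_c e2T /eqP d_c w_q2] d_q /and3P[uniq_c].
rewrite negb_or => /andP[e2c _] uniq_q2 sum_q.
have closed : dest s (e :: c) = s by rewrite /dest /= -/(dest _ _) -d_c s_e2.
have uniq_ec : uniq [seq src x | x <- e :: c] by rewrite /= src_e s_e2 e2c.
have sum_ec : \sum_(x <- e :: c) g x = 0.
  rewrite -(cycle_sum_seq g [set x in e :: c]); last by move=> x; rewrite inE.
    apply: g0; apply: (@simple_closed_walk_cycle s (e :: c)) => //.
    by rewrite /= eT src_e eqxx.
  exact: map_uniq uniq_ec.
exists (e2 :: q2); split=> //.
- by rewrite /= e2T -s_e2 eqxx.
- by move: sum_ec; rewrite !big_cons -sum_q addrA => ->; rewrite add0r big_cons.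
Qed.

Lemma walk_sum_bounded (g : edge S (in_alph T) -> R) :
    (forall V C, directed_cycle T V C -> cycle_sum T g C = 0) ->
  forall s p, walk s p -> `|\sum_(e <- p) g e| <= \sum_e `|g e|.
Proof.
move=> g0 s p /(walk_sum_simple g g0)[q [_ _ /map_uniq uniq_q <-]].
apply: le_trans (ler_norm_sum _ _ _) _; rewrite big_uniq //.
by rewrite [leRHS](bigID [in q]) /= lerDl sumr_ge0.
Qed.

Lemma complete_walk : complete T ->
  forall s (w : seq (in_alph T)), exists2 p, walk s p & [seq inp e | e <- p] = w.
Proof.
move=> T_compl s w; elim: w s => [|x w IHw] s; first by exists [::].
have [t stx] := T_compl s x; have [p w_p i_p] := IHw t.
by exists ((s, t, x) :: p); rewrite /= ?stx ?eqxx ?i_p.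
Qed.

Lemma deterministic_walk : deterministic T -> forall s p q, walk s p -> walk s q ->
  [seq inp e | e <- p] = [seq inp e | e <- q] -> p = q.
Proof.
move=> T_det s p q; elim: p s q => [|[[s1 t1] x1] p IHp] s [|[[s2 t2] x2] q] //=.
rewrite /src /tgt /inp /= => /and3P[eT /eqP s1s w_p] /and3P[e'T /eqP s2s w_q] [x12 pq].
subst s1 s2 x2; have t12 := T_det _ _ _ _ eT e'T; subst t2.
by rewrite (IHp t1 q).
Qed.

Lemma sum_output_seq (a : 'I_S.+1 -> R) p :
  \sum_(x <- output_seq a p) x = \sum_(e <- p) delta T e + a (dest ord0 p).
Proof. by rewrite /output_seq -cats1 big_cat big_map big_seq1. Qed.

Lemma Output_run (a : 'I_S.+1 -> R) : complete T ->
  forall n (w : n.-tuple (in_alph T)), exists p, [/\ walk ord0 p, size p = n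
    & Output T a w = \sum_(e <- p) delta T e + a (dest ord0 p)].
Proof.
move=> T_compl n w; rewrite /Output; case: pickP => [p /andP[w_p _]|none].
  by exists p; rewrite size_tuple sum_output_seq.
(* Completeness provides a run on [w], so the default value in [Output] cannot occur. *)
have [p w_p i_p] := complete_walk T_compl ord0 (rev w).
have size_p : size p == n by rewrite -(size_map (@inp _ _)) i_p size_rev size_tuple.
by have := none (Tuple size_p); rewrite /run /= w_p i_p eqxx.
Qed.

(** The word is the reversed input sequence of [p], since words are read from right to left; by
    determinism the run picked in [Output] is [p] itself. *)
Lemma walk_Output (a : 'I_S.+1 -> R) : deterministic T -> forall p, walk ord0 p ->
  exists w : (size p).-tuple (in_alph T),
    Output T a w = \sum_(e <- p) delta T e + a (dest ord0 p).
Proof.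
move=> T_det p w_p.
have size_w : size (rev [seq inp e | e <- p]) == size p by rewrite size_rev size_map.
exists (Tuple size_w); rewrite /Output; case: pickP => [q|/(_ (in_tuple p))].
  rewrite /run /= revK => /andP[w_q /eqP i_q].
  by rewrite (deterministic_walk T_det _ _ _ w_q w_p i_q) sum_output_seq.
by rewrite /run /= revK w_p eqxx.
Qed.

(** Repeating a closed walk makes its weight grow linearly in [m] while the end state stays
    fixed. *)
Lemma walk_iter s c m : walk s c -> dest s c = s ->
  let p := iter m (cat c) [::] in
  [/\ walk s p, dest s p = s
    & forall g : edge S (in_alph T) -> R, \sum_(e <- p) g e = (\sum_(e <- c) g e) *+ m].
Proof.
move=> w_c d_c; elim: m => [|m [w_p d_p sum_p]] /=.
  by split=> // g; rewrite big_nil mulr0n.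
split=> [||g]; first by rewrite walk_cat w_c d_c.
  by rewrite dest_cat d_c.
by rewrite big_cat /= sum_p mulrS.
Qed.

End Walks.

(** Archimedean property: if [x] were nonzero, some natural number would exceed [M / |x|]. *)
Lemma bounded_mulrn_eq0 (R : archiRealFieldType) (x M : R) :
  (forall m : nat, `|x *+ m| <= M) -> x = 0.
Proof.
move=> bnd; apply/eqP; apply/negP => /negP x0.
have x_gt0 : 0 < `|x| by rewrite normr_gt0.
have M0 : 0 <= M := le_trans (normr_ge0 _) (bnd 0).
have := bnd (Num.bound (M / `|x|)).
rewrite normrMn -mulr_natl leNgt -ltr_pdivrMr //.
by rewrite archi_boundP // divr_ge0.
Qed.

(** Shifting the weights by [k] turns the deviation from [k n] into a plain walk sum. *)
Lemma sum_delta_sub (R : realType) (S : nat) (T : transducer R S) (k : R)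
    (p : seq (edge S (in_alph T))) :
  \sum_(e <- p) (delta T e - k) = \sum_(e <- p) delta T e - k * (size p)%:R.
Proof. by rewrite sumrB big_const_seq count_predT iter_addr_0 mulr_natr. Qed.

Theorem theorem3p3 (R : realType) (S : nat) (T : transducer R S)
    (a : 'I_S.+1 -> R)
    (T_subsequential : subsequential T a)
    (T_complete : complete T)
    (T_weakly_connected : weakly_connected T)
    (T_accessible : accessible T) :
  (exists k : R, quasi_deterministic T a k) <->
  (exists k : R,
     forall (V : {set 'I_S.+1}) (C : {set edge S (in_alph T)}),
       directed_cycle T V C ->
       cycle_sum T (delta T) C = k * cycle_sum T (fun=> 1) C).
Proof.
case: T_subsequential => T_det _ _.
have cycle_sum_sub k C : cycle_sum T (fun e => delta T e - k) C =
    cycle_sum T (delta T) C - k * cycle_sum T (fun=> 1) C.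
  by rewrite /cycle_sum sumrB mulr_sumr mulr1.
split=> [[k [M q_det]]|[k mean_k]]; exists k.
  move=> V C /cycle_closed_walk[s [c [w_c d_c uniq_c Cc]]].
  apply/eqP; rewrite -subr_eq0 -cycle_sum_sub (cycle_sum_seq _ _ _ uniq_c Cc).
  (* Accessibility gives a walk from the initial state to the cycle, so that actual runs can go
     around it [m] times. *)
  apply/eqP; have [p w_p d_p] := connect_walk _ _ (T_accessible s).
  (* [d] collects what does not depend on [m]: the approach to the cycle and the final output at
     [s]. *)
  set d := \sum_(e <- p) (delta T e - k) + a s.
  apply: (@bounded_mulrn_eq0 _ _ (M + `|d|)) => m.
  have [w_cm d_cm sum_cm] := walk_iter s c m w_c d_c.
  have w_pcm : walk ord0 (p ++ iter m (cat c) [::]) by rewrite walk_cat w_p d_p.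
  have [w w_out] := walk_Output a T_det _ w_pcm.
  rewrite -sum_cm; have := q_det _ w.
  rewrite w_out addrAC -sum_delta_sub big_cat /= dest_cat d_p d_cm addrAC -/d => bnd.
  by rewrite -lerBlDr; apply: le_trans bnd; rewrite addrC lerB_normD.
(* The first sum bounds the walk with weights [delta - k], the second the final output at any last
   state. *)
exists (\sum_e `|delta T e - k| + \sum_s `|a s|) => n w.
have [p [w_p size_p ->]] := Output_run a T_complete n w.
rewrite -size_p addrAC -sum_delta_sub; apply: le_trans (ler_normD _ _) _; apply: lerD.
  apply: walk_sum_bounded w_p => V C /mean_k eq_C.
  by rewrite cycle_sum_sub eq_C subrr.
by rewrite (bigD1 (dest ord0 p)) //= lerDl sumr_ge0.
Qed.
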